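(* Let $X$ be a locally compact Hausdorff space, and let $G$ be a discrete group acting on $X$. Suppose that $U$ is a non-empty compact open subset of $X$. Then $U$ is $(G,\tau_X)$-paradoxical if and only if there exist elements $x,y$ in $C_c(G,C_0(X)^+)$ such that $x^*x=y^*y=1_U$ and $xx^*+yy^*\le 1_U$. In this case $1_U$ is properly infinite in $C_0(X)\rtimes_r G$.
   Context: $G$ acts on $X$ by homeomorphisms, with induced action on $C_0(X)$; $C_0(X)\rtimes_r G$ is the reduced crossed product, and $t\mapsto u_t$ is the canonical unitary representation of $G$ (in the multiplier algebra) implementing the action. $C_c(G,C_0(X)^+)$ is the set of finite sums $\sum_{t\in G}a_tu_t$ in $C_0(X)\rtimes_r G$ with all $a_t\in C_0(X)$ positive and only finitely many non-zero. $\tau_X$ denotes the family of open subsets of $X$. For a family $\mathbb{E}$ of subsets of $X$, a non-empty set $U\subseteq X$ is $(G,\mathbb{E})$-paradoxical if there exist non-empty sets $V_1,\dots,V_{n+m}\in\mathbb{E}$ and elements $t_1,\dots,t_{n+m}\in G$ such that $\bigcup_{i=1}^nV_i=\bigcup_{i=n+1}^{n+m}V_i=U$ and such that the sets $(t_k.V_k)_{k=1}^{n+m}$ are pairwise disjoint subsets of $U$. A non-zero projection $p$ in a $C^*$-algebra $B$ is properly infinite if there exist partial isometries $x,y\in B$ with $x^*x=y^*y=p$ and $xx^*+yy^*\le p$. *)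

(* Defs.v *)
From HB Require Import structures.
From mathcomp Require Import all_boot all_order all_algebra.
From mathcomp Require Import all_classical all_reals all_analysis.
From mathcomp Require Import ring lra complex.

Set Implicit Arguments.
Unset Strict Implicit.
Unset Printing Implicit Defensive.

Import Order.TTheory GRing.Theory Num.Theory.
Import numFieldNormedType.Exports.
Import ComplexField.Normc.

Local Open Scope classical_set_scope.
Local Open Scope complex_scope.
Local Open Scope ring_scope.

Section ComplexModulus.
Variable R : realType.
Implicit Types z w : R[i].

Lemma normc_ge0 z : 0 <= normc z.
Proof. by case: z => a b /=; exact: sqrtr_ge0. Qed.

Lemma sqr_normcE z : normc z ^+ 2 = complex.Re z ^+ 2 + complex.Im z ^+ 2.
Proof. by case: z => a b /=; rewrite sqr_sqrtr ?addr_ge0 ?sqr_ge0. Qed.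

Lemma sqr_normcD z w :
  normc (z + w) ^+ 2 <= 2 * normc z ^+ 2 + 2 * normc w ^+ 2.
Proof.
rewrite !sqr_normcE; case: z => a b; case: w => c d /=.
have := sqr_ge0 (a - c); have := sqr_ge0 (b - d); nra.
Qed.

End ComplexModulus.

(* The Hilbert space l^2(I), for an arbitrary (possibly uncountable) I. *)
Section L2.
Context {R : realType} {I : choiceType}.
Implicit Types f g : I -> R[i].

Definition sqsum f : \bar R := \esum_(i in [set: I]) (normc (f i) ^+ 2)%:E.

Definition sqsummable : {pred (I -> R[i])} := [pred f | (sqsum f < +oo)%E].

Let sqr_ge0E f i : (0 <= (normc (f i) ^+ 2)%:E)%E.
Proof. by rewrite lee_fin sqr_ge0. Qed.

Lemma sqsum_dom (M : R) f g : 0 <= M ->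
  (forall i, normc (g i) <= M * normc (f i)) ->
  f \in sqsummable -> g \in sqsummable.
Proof.
rewrite !inE => M0 gf foo.
suff le : (sqsum g <= (M ^+ 2)%:E * sqsum f)%E.
  apply: (le_lt_trans le); rewrite lte_mul_pinfty ?lee_fin ?sqr_ge0//.
apply: (@le_trans _ _
    (\esum_(i in [set: I]) ((M ^+ 2)%:E * (normc (f i) ^+ 2)%:E))%E).
  apply: le_esum => i _; rewrite -EFinM lee_fin -exprMn.
  by rewrite ler_pXn2r ?nnegrE ?normc_ge0 ?mulr_ge0 ?normc_ge0.
apply: ge_ereal_sup => _ [A [finA _] <-].
rewrite -ge0_mule_fsumr; last by move=> i; rewrite lee_fin sqr_ge0.
apply: lee_wpmul2l; first by rewrite lee_fin sqr_ge0.
by apply: esum_ge; exists A.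
Qed.

Lemma sqsum_add f g :
  f \in sqsummable -> g \in sqsummable -> f + g \in sqsummable.
Proof.
rewrite !inE => foo goo.
have h0 (h : I -> R[i]) i : (0 <= (normc (h i) ^+ 2)%:E + (normc (h i) ^+ 2)%:E :> \bar R)%E.
  by apply: adde_ge0; exact: sqr_ge0E.
apply: (@le_lt_trans _ _ ((sqsum f + sqsum f) + (sqsum g + sqsum g))%E).
  rewrite /sqsum -!esumD; do ?[by move=> i _; first [exact: h0|exact: sqr_ge0E]].
  apply: le_esum => i _; rewrite -!EFinD lee_fin.
  by have := sqr_normcD (f i) (g i); rewrite !mulr2n !mulrDl !mul1r.
by rewrite !lte_add_pinfty.
Qed.

Fact sqsummable_submod_closed : submod_closed sqsummable.
Proof.
split=> [|a f g fP gP].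
  rewrite inE /sqsum esum1 ?ltry// => i _.
  by rewrite -[(0 : I -> R[i]) i]/(0 : R[i]) normc0 expr0n.
apply: sqsum_add => //; apply: (@sqsum_dom (normc a) f) => //.
  exact: normc_ge0.
by move=> i; rewrite -normcM.
Qed.

HB.instance Definition _ :=
  GRing.isSubmodClosed.Build _ _ sqsummable sqsummable_submod_closed.

End L2.

Record l2 (R : realType) (I : choiceType) :=
  L2 { l2_fun :> I -> R[i]; l2P : l2_fun \in sqsummable }.

HB.instance Definition _ (R : realType) (I : choiceType) :=
  [isSub for @l2_fun R I].
HB.instance Definition _ (R : realType) (I : choiceType) :=
  [Choice of l2 R I by <:].
HB.instance Definition _ (R : realType) (I : choiceType) :=
  [SubChoice_isSubLmodule of l2 R I by <:].

Section HilbertOperators.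
Context {R : realType} {I : choiceType}.
Local Notation H := (l2 R I).
Implicit Types (xi eta : H) (S T p v : H -> H) (A B : set (H -> H)).

(* Sum of an absolutely summable family; esum is only for non-negative ones. *)
Definition rsum (f : I -> R) : R :=
  fine (\esum_(i in [set: I]) (f^\+ i)%:E)
  - fine (\esum_(i in [set: I]) (f^\- i)%:E).

Definition csum (f : I -> R[i]) : R[i] :=
  rsum (fun i => complex.Re (f i)) +i* rsum (fun i => complex.Im (f i)).

Definition inner xi eta : R[i] := csum (fun i => xi i * (eta i)^*).

Definition l2norm xi : R := Num.sqrt (complex.Re (inner xi xi)).

Definition bounded_op T :=
  linear T /\ exists M : R, forall xi, l2norm (T xi) <= M * l2norm xi.

Definition is_adjoint T S :=
  forall xi eta, inner (T xi) eta = inner xi (S eta).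

(* The adjoint, which exists and is unique for every bounded T; the default
   value 0 is irrelevant on bounded operators. *)
Definition adj T : H -> H := xget (0 : H -> H) [set S | is_adjoint T S].

(* Closure in B(H) for the operator norm. *)
Definition norm_closure A : set (H -> H) :=
  [set T | bounded_op T /\
    forall e : R, 0 < e -> exists2 S, A S &
      forall xi, l2norm (T xi - S xi) <= e * l2norm xi].

(* Below, B is a C*-algebra of operators on H, with product \o. *)

Definition projection p := adj p = p /\ p \o p = p.

Definition partial_isometry v := projection (adj v \o v).

(* S <= T in B: the positive elements of a C*-algebra are the z^*z. *)
Definition cstar_le B S T := exists2 z, B z & T - S = adj z \o z.

Definition properly_infinite B p :=
  [/\ B p, p <> 0, projection p &
      exists x y, [/\ B x, B y, partial_isometry x, partial_isometry y &
        [/\ adj x \o x = p, adj y \o y = p &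
            cstar_le B ((x \o adj x) + (y \o adj y)) p]]].

End HilbertOperators.

(* Continuity is with respect to the norm topology of R[i], which the library
   attaches to R[i]^o. *)
Record C0 (R : realType) (X : topologicalType) := MkC0 {
  C0_fun :> X -> R[i];
  C0_continuous : continuous (C0_fun : X -> R[i]^o);
  C0_vanish : forall e : R, 0 < e -> compact [set x | e <= normc (C0_fun x)] }.

Section C0Theory.
Context {R : realType} {X : topologicalType}.

Lemma C0_bounded (a : C0 R X) :
  exists2 M : R, 0 <= M & forall x, normc (a x) <= M.
Proof.
have /compact_near_coveringP := @C0_vanish _ _ a 1 ltr01.
move=> /(_ R (pinfty_nbhs R) (fun M x => normc (a x) <= M) _) [].
  move=> x _; have /cvgrPdist_lt /(_ 1 ltr01) ax := @C0_continuous _ _ a x.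
  exists ([set y | `|a x - a y| < (1 : R[i])],
          [set M | 2 * normc (a x) ^+ 2 + 3 <= M]).
    by split=> //=; apply: nbhs_pinfty_ge; exact: num_real.
  move=> [y M] /= [dxy hM].
  have d1 : normc (a x - a y) < 1.
    by move: dxy; rewrite normc_def -[1]/((1 : R)%:C) ltcR; case: (a x - a y).
  have := sqr_normcD (- (a x - a y)) (a x); rewrite opprB subrK.
  have -> : normc (a y - a x) = normc (a x - a y).
    by rewrite -opprB; case: (a x - a y) => u w /=; rewrite !sqrrN.
  have := normc_ge0 (a x - a y); have := normc_ge0 (a y); nra.
move=> M0 [_ hM0].
pose M := Num.max 1 (M0 + 1); exists M.
  by rewrite le_max ler01.
move=> x; have [ax|/ltW ax] := leP 1 (normc (a x)).
  by apply: hM0 => //; rewrite lt_max ltrDl ltr01 orbT.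
by rewrite le_max ax.
Qed.

Fact C0_indic_continuous (U : set X) : hausdorff_space X -> compact U ->
  open U -> continuous ((fun x => (\1_U x : R)%:C) : X -> R[i]^o).
Proof.
move=> hX cU oU x; have clU := compact_closed hX cU.
apply: cvg_near_cst; have [xU|xU] := pselect (U x).
  have : \near x, U x by exact: open_nbhs_nbhs.
  by apply: filterS => y yU; rewrite !indicE !mem_set.
have : \near x, (~` U) x.
  by apply: open_nbhs_nbhs; split=> //; exact: closed_openC.
by apply: filterS => y yU; rewrite !indicE !memNset.
Qed.

Fact C0_indic_vanish (U : set X) : compact U ->
  forall e : R, 0 < e -> compact [set x | e <= normc ((\1_U x : R)%:C)].
Proof.
move=> cU e e0.
have nE x : normc ((\1_U x : R)%:C) = \1_U x.
  by rewrite /= expr0n addr0 sqrtr_sqr ger0_norm// indicE ler0n.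
rewrite (_ : mkset _ = [set x | e <= \1_U x]); last first.
  by congr mkset; apply/funext => x; rewrite nE.
have [e1|e1] := leP e 1.
  rewrite (_ : mkset _ = U)//; apply/seteqP; split=> x /=; rewrite indicE.
    have [//|xU] := pselect (U x).
    by rewrite memNset// leNgt e0.
  by move=> xU; rewrite mem_set.
rewrite (_ : mkset _ = set0); first exact: compact0.
apply/seteqP; split=> x //=; rewrite indicE; case: (x \in U).
  by rewrite leNgt e1.
by rewrite leNgt e0.
Qed.

Definition C0_indic (U : set X) (hX : hausdorff_space X) (cU : compact U)
    (oU : open U) : C0 R X :=
  MkC0 (C0_indic_continuous hX cU oU) (C0_indic_vanish cU).

End C0Theory.

Section Action.
Context {X : topologicalType} {G : groupType}.
Implicit Types (act : G -> X -> X) (E : set (set X)) (U : set X).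

(* Actions by homeomorphisms: the inverse of act t is act t^-1. *)
Definition continuous_action act :=
  [/\ forall x, act 1%g x = x,
      forall s t x, act (s * t)%g x = act s (act t x) &
      forall t, continuous (act t)].

Definition paradoxical act E U :=
  U !=set0 /\
  exists n m (V : 'I_(n + m) -> set X) (t : 'I_(n + m) -> G),
    [/\ forall k, E (V k) /\ V k !=set0,
        \bigcup_(i in [set: 'I_n]) V (lshift m i) = U,
        \bigcup_(j in [set: 'I_m]) V (rshift n j) = U,
        trivIset [set: 'I_(n + m)] (fun k => act (t k) @` V k) &
        forall k, act (t k) @` V k `<=` U].

End Action.

(* The reduced crossed product, as the C*-algebra of operators on
   l^2(G x X) = l^2(G) (x) l^2(X) given by the regular representation induced
   from the faithful representation of C_0(X) on l^2(X) by multiplication: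
     (a xi)(s, x) = (s^-1.a)(x) xi(s, x)  with  (s^-1.a)(x) = a(s.x),
     (u_t xi)(s, x) = xi(t^-1 s, x),
   so that u_t a u_t^* = t.a.  Up to canonical isomorphism, the algebra does
   not depend on the faithful representation from which it is induced. *)
Section CrossedProduct.
Context {R : realType} {X : topologicalType} {G : groupType}.
Variable act : G -> X -> X.
Local Notation I := (G * X)%type.
Local Notation H := (l2 R I).

Fact coef_subproof (a : C0 R X) (xi : H) :
  (fun i : I => a (act i.1 i.2) * xi i) \in sqsummable.
Proof.
have [M M0 aM] := C0_bounded a; apply: sqsum_dom M0 _ (l2P xi) => i.
by rewrite normcM ler_wpM2r ?normc_ge0.
Qed.

Definition coef (a : C0 R X) : H -> H := fun xi => L2 (coef_subproof a xi).

Fact unitary_subproof (t : G) (xi : H) :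
  (fun i : I => xi ((t^-1 * i.1)%g, i.2)) \in sqsummable.
Proof.
have := l2P xi; rewrite !inE /sqsum.
rewrite (@reindex_esum _ _ _ [set: I] [set: I]
  (fun i : I => ((t^-1 * i.1)%g, i.2)))//.
split=> [//|[s x] [s' x'] _ _ [] /mulgI -> -> //|[s x] _].
by exists ((t * s)%g, x); rewrite //= mulKg.
Qed.

Definition unitary (t : G) : H -> H := fun xi => L2 (unitary_subproof t xi).

Definition Cc_sum (a : G -> C0 R X) : H -> H :=
  \sum_(t \in [set t | (a t : X -> R[i]) != 0]) (coef (a t) \o unitary t).

Definition finsupp (a : G -> C0 R X) :=
  finite_set [set t | (a t : X -> R[i]) != 0].

Definition Cc : set (H -> H) := [set Cc_sum a | a in finsupp].

Definition Cc_pos : set (H -> H) :=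
  [set Cc_sum a | a in [set a | finsupp a /\ forall t x, 0 <= a t x]].

Definition reduced_crossed_product : set (H -> H) := norm_closure Cc.

End CrossedProduct.

(* Main.v *)
(* On vectors of l^2(G x X), a sum of a_j u_(t_j) and its adjoint act by explicit
   finite sums, and all relations below are read off pointwise.

   If U is paradoxical, a partition of unity subordinate to the V_k provides
   h_k >= 0 supported in V_k, with squares summing to 1_U over each of the two
   groups of indices.  Put x = sum_k u_(t_k) h_k over the first group, and define
   y likewise over the second one: as the t_k.V_k are disjoint,
   x^*x = y^*y = 1_U and x^*y = 0, and 1_U - xx^* - yy^* is a projection q = q^*q.

   Conversely, xx^* + yy^* <= 1_U forces 1_U x = x, 1_U y = y and y^*x = 0.
   Write x = sum_s a_s u_s and y = sum_s b_s u_s.  All coefficients being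
   non-negative, the coefficients of x^*x = 1_U and y^*x = 0 show that the sets
   {a_s <> 0} and {b_s <> 0} are pairwise disjoint subsets of U, while their
   translates by s^-1 cover U, once for x and once for y. *)
Require Import Defs.
From mathcomp Require Import all_boot all_order all_algebra.
From mathcomp Require Import all_classical all_reals all_analysis.
From mathcomp Require Import lra complex.

Set Implicit Arguments.
Unset Strict Implicit.
Unset Printing Implicit Defensive.

Import Order.TTheory GRing.Theory Num.Theory.
Import numFieldNormedType.Exports.
Import ComplexField.Normc.

Local Open Scope classical_set_scope.
Local Open Scope complex_scope.
Local Open Scope ring_scope.

(** * Sums of absolutely summable families *)

Section AbsolutelySummable.
Context {R : realType} {I : choiceType}.
Implicit Types f g h : I -> R.

Definition abs_summable f :=
  (\esum_(i in [set: I]) (`|f i|)%:E < +oo)%E.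

Lemma abs_summable_le f g : (forall i, `|f i| <= g i) ->
  (\esum_(i in [set: I]) (g i)%:E < +oo)%E -> abs_summable f.
Proof.
move=> fg; apply: le_lt_trans; apply: le_esum => i _.
by rewrite lee_fin.
Qed.

Lemma esum_fin_num g : (forall i, 0 <= g i) ->
  (\esum_(i in [set: I]) (g i)%:E < +oo)%E ->
  \esum_(i in [set: I]) (g i)%:E \is a fin_num.
Proof.
by move=> g0 gs; rewrite ge0_fin_numE// esum_ge0// => i _; rewrite lee_fin.
Qed.

(** Any splitting into non-negative summable families computes [rsum], not only the one into
    positive and negative parts. Additivity rests on this, as the positive part of a sum is not in
    general the sum of the positive parts. *)
Lemma rsumB g h : (forall i, 0 <= g i) -> (forall i, 0 <= h i) ->
  (\esum_(i in [set: I]) (g i)%:E < +oo)%E ->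
  (\esum_(i in [set: I]) (h i)%:E < +oo)%E ->
  rsum (fun i => g i - h i) = fine (\esum_(i in [set: I]) (g i)%:E) -
                              fine (\esum_(i in [set: I]) (h i)%:E).
Proof.
move=> g0 h0 gs hs; rewrite /rsum; set f := fun i => g i - h i.
have fpg i : f^\+ i <= g i.
  by rewrite /funrpos ge_max g0 andbT lerBlDr lerDl.
have fnh i : f^\- i <= h i.
  by rewrite /funrneg ge_max h0 andbT opprB lerBlDr lerDl.
have fps : (\esum_(i in [set: I]) (f^\+ i)%:E < +oo)%E.
  by apply: le_lt_trans gs; apply: le_esum => i _; rewrite lee_fin.
have fns : (\esum_(i in [set: I]) (f^\- i)%:E < +oo)%E.
  by apply: le_lt_trans hs; apply: le_esum => i _; rewrite lee_fin.
have fp0 i : 0 <= f^\+ i by exact: funrpos_ge0.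
have fn0 i : 0 <= f^\- i by exact: funrneg_ge0.
(* The identity f^+ - f^- = g - h is rearranged so that all terms are non-negative, where [esum] is
   additive. *)
have : (\esum_(i in [set: I]) (f^\+ i)%:E + \esum_(i in [set: I]) (h i)%:E =
        \esum_(i in [set: I]) (f^\- i)%:E + \esum_(i in [set: I]) (g i)%:E)%E.
  rewrite -!esumD; do ?[by move=> i _; rewrite lee_fin].
  apply: eq_esum => i _; rewrite -!EFinD; congr EFin.
  have /(congr1 (fun k => k i)) := funrposBneg f; rewrite /f !fctE; lra.
move: (esum_fin_num fp0 fps) (esum_fin_num fn0 fns)
  (esum_fin_num g0 gs) (esum_fin_num h0 hs).
move=> /fineK <- /fineK <- /fineK <- /fineK <- [] /=; lra.
Qed.

Lemma abs_summable_funrpos f : abs_summable f ->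
  (\esum_(i in [set: I]) (f^\+ i)%:E < +oo)%E.
Proof.
apply: le_lt_trans; apply: le_esum => i _.
by rewrite lee_fin ge_max ler_norm normr_ge0.
Qed.

Lemma abs_summable_funrneg f : abs_summable f ->
  (\esum_(i in [set: I]) (f^\- i)%:E < +oo)%E.
Proof.
apply: le_lt_trans; apply: le_esum => i _.
by rewrite lee_fin ge_max -normrN ler_norm normr_ge0.
Qed.

Lemma rsumD f g : abs_summable f -> abs_summable g ->
  rsum (fun i => f i + g i) = rsum f + rsum g.
Proof.
move=> fs gs.
have := abs_summable_funrpos fs; have := abs_summable_funrneg fs.
have := abs_summable_funrpos gs; have := abs_summable_funrneg gs.
move=> gns gps fns fps.
have -> : (fun i => f i + g i) =
    (fun i => (f^\+ i + g^\+ i) - (f^\- i + g^\- i)).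
  by apply/funext => i; have /(congr1 (fun k => k i)) := funrDB f g.
have ge0 (k : I -> R) i : 0 <= k^\+ i /\ 0 <= k^\- i.
  by rewrite funrpos_ge0 funrneg_ge0.
have D (h k : I -> R) : (forall i, 0 <= h i) -> (forall i, 0 <= k i) ->
   (\esum_(i in [set: I]) (h i + k i)%:E =
    \esum_(i in [set: I]) (h i)%:E + \esum_(i in [set: I]) (k i)%:E)%E.
  by move=> h0 k0; rewrite -esumD// => i _; rewrite lee_fin.
have [fp gp] : (forall i, 0 <= f^\+ i) /\ (forall i, 0 <= g^\+ i).
  by split=> i; apply ge0.
have [fn gn] : (forall i, 0 <= f^\- i) /\ (forall i, 0 <= g^\- i).
  by split=> i; apply ge0.
rewrite rsumB; last 4 first.
- by move=> i; rewrite addr_ge0.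
- by move=> i; rewrite addr_ge0.
- by rewrite D// lte_add_pinfty.
- by rewrite D// lte_add_pinfty.
rewrite !D// !fineD ?esum_fin_num// /rsum; lra.
Qed.

Lemma rsumN f : rsum (fun i => - f i) = - rsum f.
Proof.
have -> : (fun i => - f i) = \- f by [].
by rewrite /rsum funrposN funrnegN opprB.
Qed.

Lemma rsum_ge0E f : (forall i, 0 <= f i) ->
  rsum f = fine (\esum_(i in [set: I]) (f i)%:E).
Proof.
move=> f0; rewrite /rsum.
have E1 i : f^\+ i = f i by rewrite /funrpos; apply/max_idPl.
have E2 i : f^\- i = 0 by rewrite /funrneg; apply/max_idPr; rewrite oppr_le0.
under eq_esum do rewrite E1.
by rewrite [X in _ - fine X]esum1 ?subr0// => i _; rewrite E2.
Qed.

End AbsolutelySummable.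

Lemma reindex_rsum (R : realType) (I J : choiceType) (e : I -> J) (f : J -> R) :
  bijective e -> rsum (f \o e) = rsum f.
Proof.
move=> be; rewrite /rsum; congr (fine _ - fine _); symmetry.
  by apply: reindex_esum; rewrite setTT_bijective.
by apply: reindex_esum; rewrite setTT_bijective.
Qed.

Lemma reindex_csum (R : realType) (I J : choiceType) (e : I -> J) (f : J -> R[i]) :
  bijective e -> csum (f \o e) = csum f.
Proof.
move=> be; rewrite /csum -[X in _ = X +i* _](reindex_rsum _ be).
by rewrite -[X in _ = _ +i* X](reindex_rsum _ be).
Qed.

(** * The inner product of l^2(I) *)

Section Inner.
Context {R : realType} {I : choiceType}.
Local Notation H := (l2 R I).
Implicit Types xi eta zeta : H.

Lemma conj_complexE (a b : R) : (a +i* b)^* = a +i* (- b).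
Proof. by []. Qed.

Lemma normc_conj (z : R[i]) : normc z^* = normc z.
Proof. by case: z => u v; rewrite conj_complexE /= sqrrN. Qed.

Lemma csumD (f g : I -> R[i]) :
  abs_summable (fun i => normc (f i)) -> abs_summable (fun i => normc (g i)) ->
  csum (fun i => f i + g i) = csum f + csum g.
Proof.
move=> fs gs.
have nRe (z : R[i]) : `|complex.Re z| <= normc z.
  rewrite -(@ler_pXn2r _ 2) ?nnegrE ?normr_ge0 ?normc_ge0// sqr_normcE.
  by rewrite real_normK ?num_real// lerDl sqr_ge0.
have nIm (z : R[i]) : `|complex.Im z| <= normc z.
  rewrite -(@ler_pXn2r _ 2) ?nnegrE ?normr_ge0 ?normc_ge0// sqr_normcE.
  by rewrite real_normK ?num_real// lerDr sqr_ge0.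
have S (p : R[i] -> R) (h : I -> R[i]) : (forall z, `|p z| <= normc z) ->
    abs_summable (fun i => normc (h i)) -> abs_summable (fun i => p (h i)).
  move=> pn; apply: le_lt_trans; apply: le_esum => i _.
  by rewrite lee_fin (ger0_norm (normc_ge0 _)).
rewrite /csum.
have -> : (fun i => complex.Re (f i + g i)) =
          (fun i => complex.Re (f i) + complex.Re (g i)).
  by apply/funext => i; exact: raddfD.
have -> : (fun i => complex.Im (f i + g i)) =
          (fun i => complex.Im (f i) + complex.Im (g i)).
  by apply/funext => i; exact: raddfD.
by rewrite !rsumD; do ?[by apply: S].
Qed.

Lemma csum_conj (f : I -> R[i]) : csum (fun i => (f i)^*) = (csum f)^*.
Proof.
rewrite /csum conj_complexE -rsumN; congr (_ +i* _); congr rsum.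
  by apply/funext => i; case: (f i).
by apply/funext => i; case: (f i).
Qed.

Lemma sqsum_lty xi : (sqsum xi < +oo)%E.
Proof. by have := l2P xi; rewrite inE. Qed.

Lemma abs_summable_inner xi eta :
  abs_summable (fun i => normc (xi i * (eta i)^*)).
Proof.
apply: (@abs_summable_le _ _ _
  (fun i => normc (xi i) ^+ 2 + normc (eta i) ^+ 2)) => [i|].
  rewrite ger0_norm ?normc_ge0// normcM normc_conj.
  (* The bound ab <= a^2 + b^2 is 3/4 of the first square plus 1/4 of the second. *)
  have := sqr_ge0 (normc (xi i) - normc (eta i)).
  have := sqr_ge0 (normc (xi i) + normc (eta i)); nra.
under eq_esum do rewrite EFinD.
rewrite esumD; do ?[by move=> i _; rewrite lee_fin sqr_ge0].
by rewrite lte_add_pinfty ?sqsum_lty.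
Qed.

Lemma innerDl xi eta zeta : inner (xi + eta) zeta = inner xi zeta + inner eta zeta.
Proof.
rewrite /inner -csumD; do ?[exact: abs_summable_inner].
by congr csum; apply/funext => i; rewrite -mulrDl.
Qed.

Lemma inner_conj xi eta : inner eta xi = (inner xi eta)^*.
Proof.
rewrite /inner -csum_conj; congr csum; apply/funext => i.
by rewrite rmorphM/= conjCK mulrC.
Qed.

Lemma innerDr xi eta zeta : inner zeta (xi + eta) = inner zeta xi + inner zeta eta.
Proof. by rewrite inner_conj innerDl rmorphD/= -!inner_conj. Qed.

Lemma inner0l xi : inner 0 xi = 0.
Proof. by apply: (addrI (inner 0 xi)); rewrite -innerDl !addr0. Qed.

Lemma innerNl xi eta : inner (- xi) eta = - inner xi eta.
Proof. by apply: (addrI (inner xi eta)); rewrite -innerDl !subrr inner0l. Qed.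

Lemma inner0r xi : inner xi 0 = 0.
Proof. by apply: (addrI (inner xi 0)); rewrite -innerDr !addr0. Qed.

Lemma innerNr xi eta : inner xi (- eta) = - inner xi eta.
Proof. by apply: (addrI (inner xi eta)); rewrite -innerDr !subrr inner0r. Qed.

Lemma innerBr xi eta zeta : inner zeta (xi - eta) = inner zeta xi - inner zeta eta.
Proof. by rewrite innerDr innerNr. Qed.

Lemma inner_suml (J : finType) (f : J -> H) eta :
  inner (\sum_j f j) eta = \sum_j inner (f j) eta.
Proof.
by apply: (big_morph (inner^~ eta)) => [x y|]; rewrite ?innerDl ?inner0l.
Qed.

Lemma inner_sumr (J : finType) (f : J -> H) eta :
  inner eta (\sum_j f j) = \sum_j inner eta (f j).
Proof.
by apply: (big_morph (inner eta)) => [x y|]; rewrite ?innerDr ?inner0r.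
Qed.

Lemma inner_sqsum xi : inner xi xi = (fine (sqsum xi))%:C.
Proof.
rewrite /inner /csum; apply/eqP; rewrite eq_complex /=; apply/andP; split.
  rewrite rsum_ge0E => [|i]; last first.
    by case: (xi i) => a b /=; rewrite mulrN opprK -!expr2 addr_ge0// sqr_ge0.
  apply/eqP; congr fine; apply: eq_esum => i _; congr EFin.
  by rewrite sqr_normcE; case: (xi i) => a b /=; rewrite mulrN opprK -!expr2.
rewrite (_ : (fun i => _) = fun=> 0) ?rsum_ge0E ?esum1//.
by apply/funext => i; case: (xi i) => a b /=; rewrite mulrN mulrC addNr.
Qed.

Lemma inner_ge0 xi : 0 <= complex.Re (inner xi xi).
Proof.
rewrite inner_sqsum /= fine_ge0// esum_ge0// => i _.
by rewrite lee_fin sqr_ge0.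
Qed.

(** Each squared modulus is a one-term partial sum of [sqsum xi]. The hypothesis is an inequality
    because that is what the positivity estimates deliver. *)
Lemma inner_eq0 xi : complex.Re (inner xi xi) <= 0 -> xi = 0.
Proof.
rewrite inner_sqsum /= => le0; apply/val_inj/funext => i; apply: eq0_normc.
apply/eqP; rewrite -sqrf_eq0 eq_le sqr_ge0 andbT -lee_fin.
apply: (@le_trans _ _ (sqsum xi)).
  apply: esum_ge; exists [set i]; first by split.
  by rewrite fsbig_set1.
rewrite -[sqsum xi]fineK ?lee_fin// ge0_fin_numE ?sqsum_lty//.
by rewrite esum_ge0// => j _; rewrite lee_fin sqr_ge0.
Qed.

End Inner.

(** * Adjoints of operators on l^2(I) *)

Section Adjoint.
Context {R : realType} {I : choiceType}.
Local Notation H := (l2 R I).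
Implicit Types (xi eta : H) (S T e x y : H -> H).

Lemma inner_inj xi eta :
  (forall zeta : H, inner zeta xi = inner zeta eta) -> xi = eta.
Proof.
move=> h; apply/eqP; rewrite -subr_eq0; apply/eqP/inner_eq0.
by rewrite innerBr h subrr.
Qed.

Lemma is_adjoint_sym S T : is_adjoint T S -> is_adjoint S T.
Proof. by move=> TS xi eta; rewrite inner_conj -TS -inner_conj. Qed.

(** Adjoints are unique by non-degeneracy of the inner product, so the one chosen by [xget] is any
    one that can be exhibited. *)
Lemma adjE S T : is_adjoint T S -> adj T = S.
Proof.
move=> TS; have TaT : is_adjoint T (adj T) by apply: xgetPex; exists S.
by apply/funext => eta; apply: inner_inj => zeta; rewrite -TaT -TS.
Qed.

Lemma is_adjointD S T S' T' : is_adjoint T S -> is_adjoint T' S' ->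
  is_adjoint (T + T') (S + S').
Proof. by move=> TS TS' xi eta; rewrite innerDl TS TS' innerDr. Qed.

Lemma is_adjointN S T : is_adjoint T S -> is_adjoint (- T) (- S).
Proof. by move=> TS xi eta; rewrite innerNl TS innerNr. Qed.

Lemma is_adjoint_comp S T S' T' : is_adjoint T S -> is_adjoint T' S' ->
  is_adjoint (T \o T') (S' \o S).
Proof. by move=> TS TS' xi eta; rewrite TS TS'. Qed.

(** Moving T to the other slot of the inner product reduces additivity of T to that of [inner]. *)
Lemma is_adjoint_additive S T : is_adjoint T S ->
  (forall xi eta, T (xi + eta) = T xi + T eta) /\ (forall xi, T (- xi) = - T xi).
Proof.
move=> /is_adjoint_sym ST; split=> [xi eta|xi]; apply: inner_inj => zeta.
  by rewrite -ST !innerDr -!ST.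
by rewrite -ST !innerNr -!ST.
Qed.

(* When z has no adjoint, adj z is the default value 0. *)
Lemma adj_comp_ge0 z xi : 0 <= complex.Re (inner xi (adj z (z xi))).
Proof.
rewrite /adj; case: xgetP => [S _ zS|_]; last by rewrite inner0r.
by rewrite -zS inner_ge0.
Qed.

(** * Two operators x and y with x^*x = y^*y = e *)

Section TwoIsometries.
Variables (e x x' y y' : H -> H).
Hypotheses (ee' : is_adjoint e e) (xx' : is_adjoint x x') (yy' : is_adjoint y y').
Hypotheses (x'x : forall xi, x' (x xi) = e xi) (y'y : forall xi, y' (y xi) = e xi).

(** This yields the order relation: a self-adjoint idempotent q equals q^*q, so it witnesses xx^* +
    yy^* <= e. *)
Lemma complement_projection :
  (forall xi, e (x xi) = x xi) -> (forall xi, e (y xi) = y xi) ->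
  (forall xi, x (e xi) = x xi) -> (forall xi, y (e xi) = y xi) ->
  (forall xi, x' (y xi) = 0) ->
  let q := e - ((x \o x') + (y \o y')) in is_adjoint q q /\ q \o q = q.
Proof.
move=> ex ey xe ye x'y q.
have x'x' := is_adjoint_sym xx'; have y'y' := is_adjoint_sym yy'.
have x'e xi : x' (e xi) = x' xi.
  by apply: inner_inj => zeta; rewrite -xx' -ee' -xx' ex.
have y'e xi : y' (e xi) = y' xi.
  by apply: inner_inj => zeta; rewrite -yy' -ee' -yy' ey.
have y'x xi : y' (x xi) = 0.
  by apply: inner_inj => zeta; rewrite -yy' -x'x' x'y inner0l inner0r.
have eE xi : e (e xi) = e xi by rewrite -[LHS]x'x xe x'x.
split.
  apply: is_adjointD => //; apply: is_adjointN.
  apply: is_adjointD; first exact: (is_adjoint_comp xx' x'x').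
  exact: (is_adjoint_comp yy' y'y').
have [eD eN] := is_adjoint_additive ee'; have [xD xN] := is_adjoint_additive xx'.
have [yD yN] := is_adjoint_additive yy'; have [x'D x'N] := is_adjoint_additive x'x'.
have [y'D y'N] := is_adjoint_additive y'y'.
have qE xi : q xi = e xi - (x (x' xi) + y (y' xi)) by [].
have ex' xi : e (x' xi) = x' xi.
  by apply: inner_inj => zeta; rewrite -ee' -!xx' xe.
have ey' xi : e (y' xi) = y' xi.
  by apply: inner_inj => zeta; rewrite -ee' -!yy' ye.
(* Both x^* and y^* kill the range of q, so only the summand e of q acts on it, and e fixes it. *)
have x'q xi : x' (q xi) = 0.
  by rewrite qE x'D x'N x'D x'e x'x x'y addr0 ex' subrr.
have y'q xi : y' (q xi) = 0.
  by rewrite qE y'D y'N y'D y'e y'y y'x add0r ey' subrr.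
have eq xi : e (q xi) = q xi.
  by rewrite qE eD eN eD ex ey eE.
apply/funext => xi; rewrite /= qE eq x'q y'q.
have x0 : x 0 = 0 by apply: (addrI (x 0)); rewrite -xD !addr0.
have y0 : y 0 = 0 by apply: (addrI (y 0)); rewrite -yD !addr0.
by rewrite x0 y0 addr0 subr0.
Qed.

(** Only the quadratic form of e - xx^* - yy^* matters. On vectors killed by e it forces x^* and y^*
    to vanish, so both ranges lie under e. On a vector x xi the term xx^* already exhausts e, which
    leaves nothing for y^*. *)
Lemma orthogonal_ranges :
  (forall xi, e (e xi) = e xi) ->
  (forall xi, 0 <= complex.Re (inner xi (e xi - (x (x' xi) + y (y' xi))))) ->
  [/\ forall xi, e (x xi) = x xi, forall xi, e (y xi) = y xi &
      forall xi, y' (x xi) = 0].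
Proof.
move=> eE pos.
have x'x' := is_adjoint_sym xx'; have y'y' := is_adjoint_sym yy'.
have [eD eN] := is_adjoint_additive ee'; have [x'D x'N] := is_adjoint_additive x'x'.
have [y'D y'N] := is_adjoint_additive y'y'.
have ReD (a b : R[i]) : complex.Re (a + b) = complex.Re a + complex.Re b.
  exact: raddfD.
have ReB (a b : R[i]) : complex.Re (a - b) = complex.Re a - complex.Re b.
  exact: raddfB.
have le xi : complex.Re (inner (x' xi) (x' xi)) + complex.Re (inner (y' xi) (y' xi))
    <= complex.Re (inner xi (e xi)).
  have := pos xi; rewrite innerBr innerDr -x'x' -y'y' ReB ReD; lra.
have compl xi : x' (xi - e xi) = 0 /\ y' (xi - e xi) = 0.
  have := le (xi - e xi); rewrite eD eN eE subrr inner0r (_ : complex.Re 0 = 0)//.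
  have := inner_ge0 (x' (xi - e xi)); have := inner_ge0 (y' (xi - e xi)).
  by split; apply: inner_eq0; lra.
have x'e xi : x' (e xi) = x' xi.
  have [+ _] := compl xi; rewrite x'D x'N => /eqP; rewrite subr_eq0 => /eqP //.
have y'e xi : y' (e xi) = y' xi.
  have [_] := compl xi; rewrite y'D y'N => /eqP; rewrite subr_eq0 => /eqP //.
have ex xi : e (x xi) = x xi.
  by apply: inner_inj => zeta; rewrite -ee' -!x'x' x'e.
split=> // xi.
  by apply: inner_inj => zeta; rewrite -ee' -!y'y' y'e.
(* At x xi, the x-term and the right-hand side of [le] both reduce to the value of the form of e at
   xi. *)
apply: inner_eq0; have := le (x xi).
rewrite x'x ex -[inner (e xi) (e xi)]ee' eE -[inner (x xi) (x xi)]x'x' x'x; lra.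
Qed.

End TwoIsometries.

End Adjoint.

(** * Continuity of complex functions through the real modulus *)

Section ComplexContinuity.
Context {R : realType} {X : topologicalType}.

Lemma normr_complexE (z : R[i]) : `|z| = (normc z)%:C.
Proof. by rewrite normc_def; case: z. Qed.

Lemma normc_real (r : R) : normc r%:C = `|r|.
Proof. by rewrite /= expr0n addr0 sqrtr_sqr. Qed.

Lemma cvg_complexP (f : X -> R[i]) (x : X) :
  (f : X -> R[i]^o) y @[y --> x] --> (f x : R[i]^o) <->
  forall e : R, 0 < e -> \forall y \near x, normc (f x - f y) < e.
Proof.
split=> [/cvgrPdist_lt cf e e0|cf].
  have /cf : 0 < e%:C by rewrite ltcR.
  by apply: filterS => y; rewrite normr_complexE ltcR.
(* A positive element of [R[i]] has zero imaginary part, so real radii suffice. *)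
apply/cvgrPdist_lt => -[e e']; rewrite ltcE/= => /andP[/eqP -> e0].
by apply: filterS (cf _ e0) => y; rewrite normr_complexE ltcR.
Qed.

Lemma continuous_normc (f : X -> R[i]) :
  continuous (f : X -> R[i]^o) -> continuous (fun x => normc (f x)).
Proof.
move=> cf x; apply/cvgrPdist_lt => e e0.
have /cvg_complexP/(_ e e0) := cf x; apply: filterS => y; apply: le_lt_trans.
by rewrite -normc_real -lecR -!normr_complexE rmorphB/=
  -!normr_complexE ler_dist_dist.
Qed.

Lemma continuous_real_complex (h : X -> R) :
  continuous h -> continuous ((fun x => (h x)%:C) : X -> R[i]^o).
Proof.
move=> ch x; apply/cvg_complexP => e e0.
have /cvgrPdist_lt/(_ e e0) := ch x; apply: filterS => y.
by rewrite -rmorphB normc_real.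
Qed.
End ComplexContinuity.

(** * Algebraic operations on C_0(X) *)

Section C0Algebra.
Context {R : realType} {X : topologicalType}.
Implicit Types a b : C0 R X.

Lemma vanish_subcompact (f : X -> R[i]) (e : R) (K : set X) :
  continuous (f : X -> R[i]^o) -> compact K ->
  [set x | e <= normc (f x)] `<=` K -> compact [set x | e <= normc (f x)].
Proof.
move=> cf cK; apply: subclosed_compact cK => //.
apply: (@closed_comp _ _ (fun x => normc (f x)) [set r | e <= r]).
  by move=> x _; exact: continuous_normc.
exact: closed_ge.
Qed.

Lemma C0_dominated (f : X -> R[i]) (M : R) a : continuous (f : X -> R[i]^o) ->
  0 <= M -> (forall x, normc (f x) <= M * normc (a x)) ->
  forall e : R, 0 < e -> compact [set x | e <= normc (f x)].
Proof.
move=> cf M0 fa e e0; apply: vanish_subcompact (cf) _ _.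
  (* Dividing by M + 1 also covers M = 0. *)
  apply: (@C0_vanish _ _ a (e / (M + 1))); rewrite divr_gt0//; lra.
move=> x /= ex; rewrite ler_pdivrMr; last by lra.
apply: (le_trans ex); apply: (le_trans (fa x)).
have := normc_ge0 (a x); nra.
Qed.

Fact C0_add_continuous a b : continuous ((fun x => a x + b x) : X -> R[i]^o).
Proof. by move=> x; apply: cvgD; exact: C0_continuous. Qed.

Fact C0_add_vanish a b (e : R) :
  0 < e -> compact [set x | e <= normc (a x + b x)].
Proof.
move=> e0; apply: (@vanish_subcompact (fun x => a x + b x) e
  ([set x | e / 2 <= normc (a x)] `|` [set x | e / 2 <= normc (b x)])).
- exact: C0_add_continuous.
- by apply: compactU; apply: C0_vanish; rewrite divr_gt0.
- move=> x /= ex; have := le_trans ex (le_normcD (a x) (b x)).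
  have [|] := leP (e / 2) (normc (a x)); first by left.
  by move=> *; right; lra.
Qed.

Definition C0_add a b : C0 R X := MkC0 (@C0_add_continuous a b) (@C0_add_vanish a b).

Fact C0_mul_continuous a b : continuous ((fun x => a x * b x) : X -> R[i]^o).
Proof.
by move=> x; apply: (@cvgM R[i] X (nbhs x) _ a b); exact: C0_continuous.
Qed.

Fact C0_mul_vanish a b (e : R) :
  0 < e -> compact [set x | e <= normc (a x * b x)].
Proof.
have [M M0 bM] := C0_bounded b.
apply: (@C0_dominated _ M a) => //; first exact: C0_mul_continuous.
by move=> x; rewrite normcM mulrC ler_wpM2r ?normc_ge0.
Qed.

Definition C0_mul a b : C0 R X := MkC0 (@C0_mul_continuous a b) (@C0_mul_vanish a b).

Fact C0_opp_continuous a : continuous ((fun x => - a x) : X -> R[i]^o).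
Proof. by move=> x; apply: cvgN; exact: C0_continuous. Qed.

Fact C0_opp_vanish a (e : R) : 0 < e -> compact [set x | e <= normc (- a x)].
Proof.
apply: (@C0_dominated _ 1 a) => //; first exact: C0_opp_continuous.
by move=> x; rewrite mul1r normcN.
Qed.

Definition C0_opp a : C0 R X := MkC0 (@C0_opp_continuous a) (@C0_opp_vanish a).

Fact C0_conj_continuous a : continuous ((fun x => (a x)^*) : X -> R[i]^o).
Proof.
move=> x; apply/cvg_complexP => e e0.
have /cvg_complexP/(_ e e0) := @C0_continuous _ _ a x.
by apply: filterS => y; rewrite -rmorphB/= normc_conj.
Qed.

Fact C0_conj_vanish a (e : R) : 0 < e -> compact [set x | e <= normc (a x)^*].
Proof.
apply: (@C0_dominated _ 1 a) => //; first exact: C0_conj_continuous.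
by move=> x; rewrite mul1r normc_conj.
Qed.

Definition C0_conj a : C0 R X := MkC0 (@C0_conj_continuous a) (@C0_conj_vanish a).

Fact C0_zero_continuous : continuous ((fun=> 0) : X -> R[i]^o).
Proof. by move=> x; exact: cvg_cst. Qed.

Fact C0_zero_vanish (e : R) : 0 < e -> compact [set x : X | e <= normc (0 : R[i])].
Proof.
move=> e0; rewrite (_ : mkset _ = set0); first exact: compact0.
by apply/seteqP; split=> // x; rewrite /mkset normc0 leNgt e0.
Qed.

Definition C0_zero : C0 R X := MkC0 C0_zero_continuous C0_zero_vanish.

Lemma C0_sum (J : Type) (r : seq J) (P : pred J) (a : J -> C0 R X) :
  exists c : C0 R X, forall x, c x = \sum_(j <- r | P j) a j x.
Proof.
elim: r => [|j r [c cE]].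
  by exists C0_zero => x; rewrite big_nil.
case: (boolP (P j)) => Pj; last by exists c => x; rewrite big_cons (negPf Pj).
by exists (C0_add (a j) c) => x; rewrite big_cons Pj /= cE.
Qed.

End C0Algebra.

(** * Translation of functions by the action *)

Section Translation.
Context {R : realType} {X : topologicalType} {G : groupType}.
Variables (act : G -> X -> X) (hact : continuous_action act).

Lemma actV t : cancel (act t) (act t^-1).
Proof. by have [a1 aM _] := hact; move=> x; rewrite -aM mulVg a1. Qed.

Lemma actVr t : cancel (act t^-1) (act t).
Proof. by have [a1 aM _] := hact; move=> x; rewrite -aM mulgV a1. Qed.

Fact C0_translate_continuous t (a : C0 R X) :
  continuous ((fun x => a (act t x)) : X -> R[i]^o).
Proof.
have [_ _ ca] := hact; move=> x.
by apply: (@continuous_comp _ _ _ (act t)); [exact: ca|exact: C0_continuous].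
Qed.

Fact C0_translate_vanish t (a : C0 R X) (e : R) : 0 < e ->
  compact [set x | e <= normc (a (act t x))].
Proof.
have [_ _ ca] := hact; move=> e0.
(* The superlevel set of the translate is the image of a compact one under t^-1. *)
rewrite (_ : mkset _ = act t^-1 @` [set x | e <= normc (a x)]).
  apply: continuous_compact; last exact: C0_vanish.
  by apply: continuous_subspaceT; exact: ca.
apply/seteqP; split=> [x ex|_ [x ex <-]] /=; last by rewrite actVr.
by exists (act t x); rewrite ?actV.
Qed.

(** In the usual notation for the induced action this is t^-1.a. *)
Definition C0_translate t (a : C0 R X) : C0 R X :=
  MkC0 (@C0_translate_continuous t a) (@C0_translate_vanish t a).

End Translation.

(** * Square roots of partitions of unity on a compact open set *)

Section PartitionOfUnity.
Context {R : realType} {X : topologicalType} (hX : hausdorff_space X).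
Hypothesis lcX : locally_compact [set: X].

Lemma continuous_sum (J : finType) (f : J -> X -> R) :
  (forall j, continuous (f j)) -> continuous (fun x => \sum_j f j x).
Proof.
move=> cf; have -> : (fun x => \sum_j f j x) = \sum_j f j.
  by apply/funext => x; rewrite fct_sumE.
elim/big_ind: _ => [x|g h cg ch x|j _ x]; first exact: cvg_cst.
- exact: cvgD (cg x) (ch x).
- exact: cf.
Qed.

(** Complete regularity gives a function positive near each point. Functions with the same index j
    can be added without leaving [V j], so compactness leaves one function per index. *)
Lemma compact_subordinate_family (J : finType) (V : J -> set X) (U : set X) :
  compact U -> (forall j, open (V j)) -> U `<=` \bigcup_j V j ->
  exists f : J -> X -> R, [/\ forall j, continuous (f j),
    forall j x, 0 <= f j x, forall j x, f j x != 0 -> V j x &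
    forall x, U x -> 0 < \sum_j f j x].
Proof.
move=> cU oV UV.
(* Near covering is applied to the filter of the sets of families that contain
   all the good families above some fixed good one. *)
pose good (f : J -> X -> R) := [/\ forall j, continuous (f j),
  forall j x, 0 <= f j x & forall j x, f j x != 0 -> V j x].
pose above f0 := [set f | good f /\ forall j x, f0 j x <= f j x].
pose F := [set A | exists2 f0, good f0 & above f0 `<=` A].
have FF : Filter F.
  split.
  - exists (fun _ _ => 0) => //; split=> // [j x|j x]; first exact: cvg_cst.
    by rewrite eqxx.
  - move=> A B [f [cf f0 fV] fA] [g [cg g0 gV] gB].
    exists (fun j x => f j x + g j x).
      split=> [j x|j x|j x]; first exact: cvgD (cf j x) (cg j x).
        by rewrite addr_ge0.
      rewrite paddr_eq0// negb_and => /orP[]; [exact: fV|exact: gV].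
    move=> h [gh fgh]; split; [apply: fA|apply: gB]; split=> // j x.
      by apply: le_trans (fgh j x); rewrite lerDl.
    by apply: le_trans (fgh j x); rewrite lerDr.
  - by move=> A B AB [f gf fA]; exists f => //; exact: subset_trans AB.
have [|f gf] := (compact_near_coveringP U).1 cU _ F
    (fun f x => 0 < \sum_j f j x) FF; last first.
  move=> fU; have [cf f0 fV] := gf; exists f; split=> // x Ux.
  by apply: fU => //; split.
move=> x Ux; have [k _ Vkx] := UV x Ux.
(* The separator s is 0 at x and 1 off [V k], so 1 - s is positive near x and supported in [V k]. *)
have xV := @locally_compact_completely_regular X R lcX hX x _
  (open_closedC (oV k)) (fun nV => nV Vkx).
have [s [cs s01 s0 s1]] := (@uniform_separatorP _ R _ _).1 xV.
have sx : s x = 0 by apply: s0; exists x.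
have le1 y : s y <= 1.
  by have /(_ (s y)) := s01; rewrite /= in_itv /=;
  move=> /(_ (ex_intro2 _ _ y I erefl)) /andP[].
pose f0 (j : J) y := if j == k then 1 - s y else 0.
have f00 j y : 0 <= f0 j y by rewrite /f0; case: eqP => // _; rewrite subr_ge0.
have gf0 : good f0.
  split=> // [j y|j y]; rewrite /f0.
    case: (j == k); last exact: cvg_cst.
    by apply: cvgB; [exact: cvg_cst|exact: cs].
  have [->|_] := eqVneq j k; last by rewrite eqxx.
  apply: contraNP => nV; apply/eqP; rewrite (_ : s y = 1) ?subrr//.
  by apply: s1; exists y.
exists ([set y | 0 < f0 k y], above f0).
  split; last by exists f0.
  apply: open_nbhs_nbhs; split; last by rewrite /= /f0 eqxx sx subr0.
  apply: (@open_comp _ _ (f0 k) [set r | 0 < r]); last exact: open_gt.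
  by move=> y _; have [+ _ _] := gf0; apply.
move=> [y f] /= [f0y [[_ fge0 _] f0f]].
rewrite (bigD1 k)//=; apply: ltr_wpDr; first by apply: sumr_ge0.
exact: lt_le_trans (f0f k y).
Qed.

(** The subordinate family is divided by its sum, which is positive on U, before taking square
    roots. The squares are what appears in x^*x. *)
Lemma sqrt_partition_of_unity (J : finType) (V : J -> set X) (U : set X)
    (cU : compact U) (oU : open U) :
  (forall j, open (V j)) -> \bigcup_j V j = U ->
  exists h : J -> C0 R X, [/\ forall j x, 0 <= h j x,
    forall j x, h j x != 0 -> V j x &
    forall x, \sum_j h j x * h j x = C0_indic hX cU oU x].
Proof.
move=> oV VU.
have [|f [cf f0 fV fU]] := compact_subordinate_family cU oV; first by rewrite VU.
pose F x := \sum_j f j x.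
have cF : continuous F by exact: continuous_sum.
pose g j x := Num.sqrt (f j x / F x).
have fU0 j x : ~ U x -> f j x = 0.
  move=> nU; apply/eqP; apply: contra_notT nU => /fV Vx.
  by rewrite -VU; exists j.
have gU0 j x : ~ U x -> g j x = 0 by move=> nU; rewrite /g fU0// mul0r sqrtr0.
have cg j : continuous (g j).
  move=> x; have [Ux|nUx] := pselect (U x).
    apply: (@continuous_comp _ _ _ (fun x => f j x / F x));
      last exact: sqrt_continuous.
    apply: (@cvgM R X (nbhs x) _ (f j)); first exact: cf.
    by apply: cvgV; [rewrite gt_eqF// fU|exact: cF].
  (* U is also closed, being compact in a Hausdorff space, so off U the function vanishes on a
     neighbourhood. *)
  rewrite /continuous_at gU0//; apply: cvg_near_cst.
  have : \near x, (~` U) x.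
    apply: open_nbhs_nbhs; split=> //; rewrite openC.
    exact: compact_closed.
  by apply: filterS => y nUy; rewrite gU0.
have ch j := continuous_real_complex (cg j).
have vh j (e : R) : 0 < e -> compact [set x | e <= normc (g j x)%:C].
  move=> e0; apply: (vanish_subcompact (ch j) cU) => x.
  rewrite /mkset normc_real; apply: contraTP => nU.
  by rewrite gU0// normr0 -ltNge.
exists (fun j => MkC0 (ch j) (vh j)); split=> [j x|j x|x] /=.
- by rewrite lecR sqrtr_ge0.
- move=> gx; apply: fV; apply: contraNneq gx => fx.
  by rewrite /g fx mul0r sqrtr0.
- under eq_bigr do rewrite -rmorphM.
  rewrite -rmorph_sum /=; congr (_%:C).
  have gg j : g j x * g j x = f j x / F x.
    by rewrite -expr2 sqr_sqrtr// divr_ge0// sumr_ge0.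
  under eq_bigr do rewrite gg.
  rewrite -mulr_suml indicE; have [Ux|nUx] := pselect (U x).
    by rewrite mem_set// divff// gt_eqF// fU.
  by rewrite memNset// big1 ?mul0r// => j _; exact: fU0.
Qed.

End PartitionOfUnity.

(** * Finite sums of weighted translations *)

Section WeightedTranslations.
Context {R : realType} {X : topologicalType} {G : groupType}.
Variables (act : G -> X -> X) (hact : continuous_action act).
Local Notation I := (G * X)%type.
Local Notation H := (l2 R I).
Implicit Types (J K : finType) (xi eta : H).

Lemma l2_ext (xi eta : H) : (forall g z, xi (g, z) = eta (g, z)) -> xi = eta.
Proof. by move=> e; apply/val_inj/funext => -[g z]; exact: e. Qed.

Lemma l2_sumE J (f : J -> H) i : (\sum_j f j) i = \sum_j f j i.
Proof. by apply: (big_morph (fun xi : H => xi i)). Qed.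

(** The group elements may repeat, so products and sums keep this shape, indexed by [J * K] and
    [J + K], without collecting coefficients. *)
Definition wsum J (t : J -> G) (a : J -> C0 R X) : H -> H :=
  \sum_j (coef act (a j) \o unitary (t j)).

Lemma wsumE J (t : J -> G) (a : J -> C0 R X) xi g z :
  wsum t a xi (g, z) = \sum_j a j (act g z) * xi ((t j)^-1 * g, z)%g.
Proof. by rewrite /wsum fct_sumE l2_sumE. Qed.

Lemma is_adjoint_monomial t (a : C0 R X) :
  is_adjoint (coef act a \o unitary t : H -> H)
    (coef act (C0_conj (C0_translate hact t a)) \o unitary t^-1).
Proof.
move=> xi eta; rewrite /inner.
pose e (i : I) := (t * i.1, i.2)%g.
have be : bijective e.
  by exists (fun i => (t^-1 * i.1, i.2)%g) => -[g z]; rewrite /e/= ?mulKg ?mulVKg.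
rewrite -[LHS](reindex_csum _ be); congr csum; apply/funext => -[g z] /=.
have aM : forall s u x, act (s * u)%g x = act s (act u x) by case: hact.
by rewrite mulKg invgK aM rmorphM/= conjCK mulrA [_ * xi _]mulrC.
Qed.

Definition wadj_coef J (t : J -> G) (a : J -> C0 R X) j :=
  C0_conj (C0_translate hact (t j) (a j)).

Lemma is_adjoint_wsum J (t : J -> G) (a : J -> C0 R X) :
  is_adjoint (wsum t a) (wsum (fun j => (t j)^-1)%g (wadj_coef t a)).
Proof.
move=> xi eta; rewrite /wsum !fct_sumE inner_suml inner_sumr.
by apply: eq_bigr => j _; exact: is_adjoint_monomial.
Qed.

(** Termwise this is the covariance relation a u_t b u_s = a (t.b) u_(ts). *)
Lemma wsum_comp J K (t : J -> G) (a : J -> C0 R X) (s : K -> G) (b : K -> C0 R X) :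
  wsum t a \o wsum s b =
  wsum (fun p : J * K => t p.1 * s p.2)%g
    (fun p => C0_mul (a p.1) (C0_translate hact (t p.1)^-1%g (b p.2))).
Proof.
have aM : forall s u x, act (s * u)%g x = act s (act u x) by case: hact.
apply/funext => xi; apply: l2_ext => g z; rewrite /= !wsumE.
under eq_bigr do rewrite wsumE mulr_sumr.
rewrite pair_big; apply: eq_bigr => -[j k] _ /=.
by rewrite aM invgM mulgA mulrA.
Qed.

Lemma wsum_add J K (t : J -> G) (a : J -> C0 R X) (s : K -> G) (b : K -> C0 R X) :
  wsum t a + wsum s b =
  wsum (fun p : J + K => match p with inl j => t j | inr k => s k end)
    (fun p => match p with inl j => a j | inr k => b k end).
Proof. by rewrite /wsum big_sumType. Qed.

Lemma wsum_opp J (t : J -> G) (a : J -> C0 R X) :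
  - wsum t a = wsum t (fun j => C0_opp (a j)).
Proof.
apply/funext => xi; apply: l2_ext => g z; rewrite wsumE.
rewrite (_ : (- wsum t a) xi (g, z) = - wsum t a xi (g, z))// wsumE -sumrN.
by apply: eq_bigr => j _; rewrite mulNr.
Qed.

Lemma coef_wsum (a : C0 R X) :
  coef act a = wsum (fun _ : 'I_1 => 1%g) (fun=> a).
Proof.
apply/funext => xi; apply: l2_ext => g z; rewrite wsumE big_ord1.
by rewrite invg1 mul1g.
Qed.

(** Terms with the same group element are merged by summing over the fibres of t; the support then
    lies in the finite image of t. *)
Lemma wsum_Cc_sum J (t : J -> G) (a : J -> C0 R X) :
  exists c, [/\ finsupp c, Cc_sum act c = wsum t a &
    forall g x, c g x = \sum_(j | t j == g) a j x].
Proof.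
have [c cE] := choice (fun g => C0_sum (index_enum J) (fun j => t j == g) a).
pose r := undup [seq t j | j : J].
have supp g : (c g : X -> R[i]) != 0 -> g \in r.
  apply: contraR; rewrite mem_undup => gr; apply/eqP/funext => x.
  rewrite cE big1// => j /eqP tj; case/negP: gr.
  by rewrite -tj; apply: map_f; rewrite mem_enum.
exists c; split=> //.
  by apply: sub_finite_set (finite_seq r) => g; exact: supp.
rewrite /Cc_sum (@fsbig_fwiden _ _ _ _ r) ?undup_uniq//; last first.
  move=> g [_ cg]; apply/funext => xi; apply: l2_ext => h z /=.
  have -> : (c g : X -> R[i]) = 0 by apply/eqP; apply: contra_notT cg.
  by rewrite mul0r.
apply/funext => xi; apply: l2_ext => h z; rewrite wsumE.
rewrite fct_sumE (big_morph (fun xi : H => xi (h, z)) (id1 := 0) (op1 := +%R))//=.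
under eq_bigr do rewrite cE mulr_suml.
(* After the exchange, the index j contributes only at g = [t j]. *)
rewrite (exchange_big_dep predT)//=; apply: eq_bigr => j _.
have tjr : t j \in r by rewrite mem_undup map_f// mem_enum.
rewrite big_mkcond (bigD1_seq (t j)) ?undup_uniq//= eqxx big1 ?addr0// => g.
by rewrite eq_sym => /negPf ->.
Qed.

(** Here t lists the support without repetition. Injectivity later separates coefficients, and their
    being non-zero makes the paradoxical pieces non-empty. *)
Lemma Cc_sum_wsum (c : G -> C0 R X) : finsupp c ->
  exists n (t : 'I_n -> G), [/\ injective t,
    forall j, (c (t j) : X -> R[i]) != 0 &
    Cc_sum act c = wsum t (c \o t)].
Proof.
move=> /finite_seqP[s sE]; pose r := undup s.
have rE : [set g | (c g : X -> R[i]) != 0] = [set` r].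
  by rewrite sE; apply/seteqP; split=> g /=; rewrite mem_undup.
exists (size r), (fun j => nth 1%g r j); split.
- by move=> i j /eqP; rewrite nth_uniq ?undup_uniq// => /eqP /val_inj.
- move=> j; have : [set` r] (nth 1%g r j) by exact: mem_nth.
  by rewrite -rE.
- by rewrite /Cc_sum rE -fsbig_seq ?undup_uniq// (big_nth 1%g) big_mkord.
Qed.

Lemma Cc_wsum J (t : J -> G) (a : J -> C0 R X) : Cc act (wsum t a).
Proof. by have [c [fc <- _]] := wsum_Cc_sum t a; exists c. Qed.

Lemma Cc_pos_wsum J (t : J -> G) (a : J -> C0 R X) :
  (forall j x, 0 <= a j x) -> Cc_pos act (wsum t a).
Proof.
have [c [fc <- cE]] := wsum_Cc_sum t a.
by move=> a0; exists c => //; split=> // g x; rewrite cE sumr_ge0.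
Qed.

Lemma sqsum_le (M : R) (f g : I -> R[i]) : 0 <= M ->
  (forall i, normc (g i) <= M * normc (f i)) ->
  (sqsum g <= (M ^+ 2)%:E * sqsum f)%E.
Proof.
move=> M0 gf; apply: ge_ereal_sup => _ [A [finA _] <-].
apply: (@le_trans _ _ (\sum_(i \in A) ((M ^+ 2)%:E * (normc (f i) ^+ 2)%:E))%E).
  apply: lee_fsum => // i _; rewrite -EFinM lee_fin -exprMn.
  by rewrite ler_pXn2r ?nnegrE ?normc_ge0 ?mulr_ge0 ?normc_ge0.
rewrite -ge0_mule_fsumr; last by move=> i; rewrite lee_fin sqr_ge0.
apply: lee_wpmul2l; first by rewrite lee_fin sqr_ge0.
by apply: esum_ge; exists A.
Qed.

Lemma monomial_bounded t (a : C0 R X) : exists2 M : R, 0 <= M &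
  forall xi : H, complex.Re (inner (coef act a (unitary t xi))
      (coef act a (unitary t xi))) <= M * complex.Re (inner xi xi).
Proof.
have [M M0 aM] := C0_bounded a; exists (M ^+ 2); first exact: sqr_ge0.
have ReE (r : R) : complex.Re r%:C = r by [].
move=> xi; rewrite !inner_sqsum !ReE.
have sq0 (eta : H) : (0 <= sqsum eta)%E.
  by apply: esum_ge0 => i _; rewrite lee_fin sqr_ge0.
have sqfin (eta : H) : sqsum eta \is a fin_num.
  by rewrite ge0_fin_numE// sqsum_lty.
have uxi : sqsum (unitary t xi) = sqsum xi.
  rewrite /sqsum [RHS](@reindex_esum _ _ _ [set: I] [set: I]
    (fun i : I => ((t^-1 * i.1)%g, i.2)))// setTT_bijective.
  by exists (fun i => (t * i.1, i.2)%g) => -[g z]; rewrite /= ?mulKg ?mulVKg.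
rewrite -lee_fin EFinM !fineK// -uxi; apply: sqsum_le => // i.
by rewrite normcM ler_wpM2r ?normc_ge0.
Qed.

Lemma wsum_bounded J (t : J -> G) (a : J -> C0 R X) : exists2 M : R, 0 <= M &
  forall xi, complex.Re (inner (wsum t a xi) (wsum t a xi)) <=
             M * complex.Re (inner xi xi).
Proof.
rewrite /wsum; elim/big_ind: _ => [|S T [M M0 SM] [N N0 TN]|j _].
- by exists 0 => // xi; rewrite inner0l mul0r.
(* M and N bound squared norms; the constant comes from |S + T|^2 <= 2|S|^2 + 2|T|^2, that is, from
   |S - T|^2 >= 0. *)
- exists (2 * M + 2 * N) => [|xi]; first by rewrite addr_ge0// mulr_ge0.
  rewrite (_ : (S + T) xi = S xi + T xi)//.
  have := SM xi; have := TN xi; have := inner_ge0 (S xi - T xi).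
  rewrite !innerBr !innerDr !innerDl !innerNl; case: (inner (S xi) (S xi)).
  case: (inner (S xi) (T xi)) => ? ? ? ?; case: (inner (T xi) (S xi)) => ? ?.
  by case: (inner (T xi) (T xi)) => ? ?;
     move: (complex.Re (inner xi xi)) => /= ?; lra.
- exact: monomial_bounded.
Qed.

Lemma wsum_linear J (t : J -> G) (a : J -> C0 R X) : linear (wsum t a).
Proof.
move=> k xi eta; apply: l2_ext => g z.
have E (u v : H) i : (k *: u + v) i = k * u i + v i by [].
rewrite E !wsumE mulr_sumr -big_split; apply: eq_bigr => j _.
by rewrite E mulrDr mulrCA.
Qed.

Lemma reduced_crossed_product_wsum J (t : J -> G) (a : J -> C0 R X) :
  reduced_crossed_product act (wsum t a).
Proof.
split=> [|e e0].
  split; first exact: wsum_linear.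
  have [M M0 le] := wsum_bounded t a; exists (Num.sqrt M) => xi.
  by rewrite /l2norm -sqrtrM// ler_wsqrtr.
exists (wsum t a); first exact: Cc_wsum.
by move=> xi; rewrite subrr /l2norm inner0l sqrtr0 mulr_ge0 ?sqrtr_ge0// ltW.
Qed.

End WeightedTranslations.

(** * Products x^*y and their coefficients *)

Section Relations.
Context {R : realType} {X : topologicalType} {G : groupType}.
Variables (act : G -> X -> X) (hact : continuous_action act).
Local Notation I := (G * X)%type.
Local Notation H := (l2 R I).
Implicit Types (J K : finType) (xi eta : H).

Fact delta_subproof (i : I) : (fun j : I => (j == i)%:R : R[i]) \in sqsummable.
Proof.
rewrite inE /sqsum (_ : \esum_(j in _) _ = \esum_(j in [set i]) 1%:E)%E.
  by rewrite esum_set1 ?ltry// lee_fin.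
rewrite [RHS]esum_mkcond; apply: eq_esum => j _.
have [->|/eqP ji] := eqVneq j i.
  by rewrite mem_set// normc1 expr1n.
by rewrite memNset// normc0 expr0n.
Qed.

Definition delta (i : I) : H := L2 (delta_subproof i).

Lemma deltaE (i j : I) : delta i j = (j == i)%:R.
Proof. by []. Qed.

Lemma coefE (c : C0 R X) xi g z : coef act c xi (g, z) = c (act g z) * xi (g, z).
Proof. by []. Qed.

Lemma act1 z : act 1%g z = z.
Proof. by case: hact. Qed.

Lemma actM s t z : act (s * t)%g z = act s (act t z).
Proof. by case: hact. Qed.

Lemma is_adjoint_coef (c : C0 R X) : (forall x, (c x)^* = c x) ->
  is_adjoint (coef act c) (coef act c).
Proof.
move=> cr xi eta; rewrite /inner; congr csum; apply/funext => -[g z].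
by rewrite !coefE rmorphM/= cr -mulrA mulrCA.
Qed.

(** The pair (j, k) contributes to x^*y a multiple of u at t_j^-1 s_k, with coefficient a_j^* b_k
    translated by t_j. *)
Lemma wadj_wsumE J K (t : J -> G) (a : J -> C0 R X) (s : K -> G) (b : K -> C0 R X)
    xi g z :
  wsum act (fun j => (t j)^-1)%g (wadj_coef hact t a) (wsum act s b xi) (g, z) =
  \sum_j \sum_k (a j (act (t j) (act g z)))^* * b k (act (t j) (act g z)) *
    xi ((s k)^-1 * (t j * g), z)%g.
Proof.
rewrite wsumE; apply: eq_bigr => j _; rewrite wsumE mulr_sumr.
by apply: eq_bigr => k _; rewrite invgK actM mulrA.
Qed.

Lemma wsum_orthogonal J K (t : J -> G) (a : J -> C0 R X) (s : K -> G)
    (b : K -> C0 R X) xi : (forall j k w, a j w * b k w = 0) ->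
  wsum act (fun j => (t j)^-1)%g (wadj_coef hact t a) (wsum act s b xi) = 0.
Proof.
move=> ab; apply: l2_ext => g z; rewrite wadj_wsumE big1// => j _.
rewrite big1// => k _; move/eqP: (ab j k (act (t j) (act g z))).
by rewrite mulf_eq0 => /orP[]/eqP ->; rewrite ?conjC0 ?mulr0 !mul0r.
Qed.

(** Disjoint supports kill the off-diagonal pairs; on the diagonal the group part is t_j^-1 t_j = 1,
    which leaves a multiplication operator. *)
Lemma wsum_isometry J (t : J -> G) (a : J -> C0 R X) (c : C0 R X) xi :
  (forall j k w, j != k -> a j w * a k w = 0) ->
  (forall w, \sum_j (a j (act (t j) w))^* * a j (act (t j) w) = c w) ->
  wsum act (fun j => (t j)^-1)%g (wadj_coef hact t a) (wsum act t a xi) =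
  coef act c xi.
Proof.
move=> aa ac; apply: l2_ext => g z; rewrite wadj_wsumE coefE -ac mulr_suml.
apply: eq_bigr => j _; rewrite (bigD1 j)//= mulKg big1 ?addr0// => k kj.
move/eqP: (aa k j (act (t j) (act g z)) kj).
by rewrite mulf_eq0 => /orP[]/eqP ->; rewrite ?conjC0 ?mulr0 !mul0r.
Qed.

Lemma coef_wsum_id J (t : J -> G) (a : J -> C0 R X) (c : C0 R X) xi :
  (forall j w, c w * a j w = a j w) ->
  coef act c (wsum act t a xi) = wsum act t a xi.
Proof.
move=> ca; apply: l2_ext => g z; rewrite coefE wsumE mulr_sumr.
by apply: eq_bigr => j _; rewrite mulrA ca.
Qed.

Lemma wsum_coef_id J (t : J -> G) (a : J -> C0 R X) (c : C0 R X) xi :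
  (forall j w, a j w * c (act (t j)^-1%g w) = a j w) ->
  wsum act t a (coef act c xi) = wsum act t a xi.
Proof.
move=> ac; apply: l2_ext => g z; rewrite !wsumE.
by apply: eq_bigr => j _; rewrite coefE actM mulrA ac.
Qed.

(** The basis vector selects the pairs (i, l) with s_l^-1 t_i = s_k^-1 t_j. Several may survive, but
    positivity excludes cancellation, so the term of (j, k) vanishes by itself. *)
Lemma wadj_wsum_delta J K (t : J -> G) (a : J -> C0 R X) (s : K -> G)
    (b : K -> C0 R X) z j k :
  (forall i x, 0 <= a i x) -> (forall i x, 0 <= b i x) ->
  wsum act (fun j => (t j)^-1)%g (wadj_coef hact t a)
    (wsum act s b (delta ((s k)^-1 * t j, z)%g)) (1%g, z) = 0 ->
  a j (act (t j) z) * b k (act (t j) z) = 0.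
Proof.
move=> a0 b0; rewrite wadj_wsumE.
have ge0 i l : 0 <= (a i (act (t i) (act 1%g z)))^* * b l (act (t i) (act 1%g z)) *
    delta ((s k)^-1 * t j, z)%g ((s l)^-1 * (t i * 1), z)%g.
  by rewrite mulr_ge0 ?ler0n// mulr_ge0// conjC_ge0.
move/eqP; rewrite psumr_eq0 => [/allP/(_ j)|i _]; last exact: sumr_ge0.
rewrite mem_index_enum => /(_ isT) /=; rewrite psumr_eq0 => [/allP/(_ k)|i _] //.
rewrite mem_index_enum => /(_ isT) /=.
rewrite mulg1 eqxx mulr1 act1 => /eqP.
by rewrite (CrealP (ger0_real _)).
Qed.

End Relations.

(** * Paradoxical decompositions and isometries over 1_U *)

Section Paradoxical.
Context {R : realType} {X : topologicalType} {G : groupType}.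
Variables (act : G -> X -> X) (hX : hausdorff_space X).
Hypothesis hact : continuous_action act.
Variables (U : set X) (cU : compact U) (oU : open U).
Local Notation I := (G * X)%type.
Implicit Types (J K : finType).
Local Notation H := (l2 R I).
Local Notation B := (@reduced_crossed_product R X G act).
Local Notation indU := (@C0_indic R X U hX cU oU).
Local Notation oneU := (coef act indU : H -> H).

Lemma indUE w : indU w = (w \in U)%:R.
Proof. by rewrite /= indicE; case: (w \in U). Qed.

Lemma oneU_selfadjoint : is_adjoint oneU oneU.
Proof. by apply: is_adjoint_coef => x; rewrite indUE conjC_nat. Qed.

Lemma oneU_idempotent xi : oneU (oneU xi) = oneU xi.
Proof.
apply: l2_ext => g z; rewrite !coefE indUE.
by case: (_ \in U); rewrite ?mul0r ?mul1r.
Qed.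

Lemma paradoxical_isometries : locally_compact [set: X] ->
  paradoxical act open U -> exists x y : H -> H,
    [/\ Cc_pos act x, Cc_pos act y, adj x \o x = oneU, adj y \o y = oneU &
        cstar_le B ((x \o adj x) + (y \o adj y)) oneU].
Proof.
move=> lcX [_ [n [m [V [t [EV Vl Vr tV VU]]]]]].
have [h [h0 hV hU]] := @sqrt_partition_of_unity R X hX lcX _
  (fun i => V (lshift m i)) U cU oU (fun i => (EV _).1) Vl.
have [k [k0 kV kU]] := @sqrt_partition_of_unity R X hX lcX _
  (fun i => V (rshift n i)) U cU oU (fun i => (EV _).1) Vr.
pose s i := t (lshift m i); pose r i := t (rshift n i).
(* Moving the group element to the right turns u_s h into (s.h) u_s; the new coefficient is
   supported in s.V. *)
pose a i := C0_translate hact (s i)^-1%g (h i).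
pose b i := C0_translate hact (r i)^-1%g (k i).
have aV i w : a i w != 0 -> (act (s i) @` V (lshift m i)) w.
  by move=> /hV ?; exists (act (s i)^-1%g w); rewrite ?actVr.
have bV i w : b i w != 0 -> (act (r i) @` V (rshift n i)) w.
  by move=> /kV ?; exists (act (r i)^-1%g w); rewrite ?actVr.
have disj p q w : (act (t p) @` V p) w -> (act (t q) @` V q) w -> p = q.
  by move=> pw qw; apply: tV => //; exists w.
have ab i j w : a i w * b j w = 0.
  apply/eqP/negPn/negP; rewrite mulf_eq0 negb_or => /andP[/aV aw /bV bw].
  (* An index of the first group is below n and one of the second is at least n. *)
  have /(congr1 val)/= ij := disj _ _ _ aw bw.
  by have := ltn_ord i; rewrite ij ltnNge leq_addr.
have aa i j w : i != j -> a i w * a j w = 0.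
  apply: contra_neqP; move/eqP; rewrite mulf_eq0 negb_or => /andP[/aV aw /aV bw].
  exact: lshift_inj (disj _ _ _ aw bw).
have bb i j w : i != j -> b i w * b j w = 0.
  apply: contra_neqP; move/eqP; rewrite mulf_eq0 negb_or => /andP[/bV aw /bV bw].
  exact: rshift_inj (disj _ _ _ aw bw).
have subU p z : V p z -> U z.
  have [i ->|i ->] := split_ordP p => Vz; first by rewrite -Vl; exists i.
  by rewrite -Vr; exists i.
have Ua i w : indU w * a i w = a i w.
  rewrite indUE; have [->|/aV aw] := eqVneq (a i w) 0; first exact: mulr0.
  by rewrite mem_set ?mul1r//; exact: VU aw.
have Ub i w : indU w * b i w = b i w.
  rewrite indUE; have [->|/bV aw] := eqVneq (b i w) 0; first exact: mulr0.
  by rewrite mem_set ?mul1r//; exact: VU aw.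
have aU i w : a i w * indU (act (s i)^-1%g w) = a i w.
  rewrite indUE; have [->|/hV aw] := eqVneq (a i w) 0; first exact: mul0r.
  by rewrite mem_set ?mulr1//; exact: subU aw.
have bU i w : b i w * indU (act (r i)^-1%g w) = b i w.
  rewrite indUE; have [->|/kV aw] := eqVneq (b i w) 0; first exact: mul0r.
  by rewrite mem_set ?mulr1//; exact: subU aw.
have asum w : \sum_i (a i (act (s i) w))^* * a i (act (s i) w) = indU w.
  rewrite -hU; apply: eq_bigr => i _; rewrite /= (actV hact).
  by rewrite (CrealP (ger0_real _)).
have bsum w : \sum_i (b i (act (r i) w))^* * b i (act (r i) w) = indU w.
  rewrite -kU; apply: eq_bigr => i _; rewrite /= (actV hact).
  by rewrite (CrealP (ger0_real _)).
pose x : H -> H := wsum act s a; pose y : H -> H := wsum act r b.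
pose x' : H -> H := wsum act (fun i => (s i)^-1)%g (wadj_coef hact s a).
pose y' : H -> H := wsum act (fun i => (r i)^-1)%g (wadj_coef hact r b).
have xx' : is_adjoint x x' by exact: is_adjoint_wsum.
have yy' : is_adjoint y y' by exact: is_adjoint_wsum.
have x'x xi : x' (x xi) = oneU xi by exact: wsum_isometry.
have y'y xi : y' (y xi) = oneU xi by exact: wsum_isometry.
have ex xi : oneU (x xi) = x xi by exact: coef_wsum_id.
have ey xi : oneU (y xi) = y xi by exact: coef_wsum_id.
have xe xi : x (oneU xi) = x xi by exact: wsum_coef_id.
have ye xi : y (oneU xi) = y xi by exact: wsum_coef_id.
have x'y xi : x' (y xi) = 0 by exact: wsum_orthogonal.
have [qq q2] := complement_projection oneU_selfadjoint
  xx' yy' x'x y'y ex ey xe ye x'y.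
exists x, y; split.
- by apply: Cc_pos_wsum => i w; exact: h0.
- by apply: Cc_pos_wsum => i w; exact: k0.
- by rewrite (adjE xx'); apply/funext.
- by rewrite (adjE yy'); apply/funext.
rewrite (adjE xx') (adjE yy').
exists (oneU - ((x \o x') + (y \o y'))); last by rewrite (adjE qq) q2.
(* The projection is itself rewritten as a single finite weighted sum, which places it in [B]. *)
rewrite coef_wsum /x /x' /y /y' !wsum_comp wsum_add wsum_opp wsum_add.
exact: reduced_crossed_product_wsum.
Qed.

Lemma isometries_properly_infinite (x y : H -> H) : U !=set0 ->
  Cc_pos act x -> Cc_pos act y -> adj x \o x = oneU -> adj y \o y = oneU ->
  cstar_le B ((x \o adj x) + (y \o adj y)) oneU ->
  properly_infinite B oneU.
Proof.
move=> [u Uu] xP yP x'x y'y xy.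
have CcB z : Cc_pos act z -> B z.
  move=> [c [fc _] <-]; have [n [t [_ _ ->]]] := Cc_sum_wsum act fc.
  exact: reduced_crossed_product_wsum.
have pU : projection oneU.
  split; first exact: adjE oneU_selfadjoint.
  by apply/funext => xi; exact: oneU_idempotent.
split=> //.
- by rewrite coef_wsum; exact: reduced_crossed_product_wsum.
(* For u in U, 1_U fixes the basis vector at (1, u), so it is not 0. *)
- move/(congr1 (fun T : H -> H => T (delta (1%g, u)) (1%g, u))).
  rewrite coefE deltaE eqxx indUE (act1 hact) mem_set// mul1r.
  by move/eqP; rewrite oner_eq0.
exists x, y; split; [exact: CcB|exact: CcB| | |split=> //].
  by rewrite /partial_isometry x'x.
by rewrite /partial_isometry y'y.
Qed.

(** The conclusions are read from x^*x = 1_U in turn: off the diagonal, on the diagonal outside U,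
    and on the diagonal inside U. *)
Lemma isometry_coefs J (t : J -> G) (a : J -> C0 R X) :
  injective t -> (forall j w, 0 <= a j w) ->
  (forall xi, wsum act (fun j => (t j)^-1)%g (wadj_coef hact t a)
    (wsum act t a xi) = oneU xi) ->
  [/\ forall i j w, i != j -> a i w * a j w = 0,
      forall j z, a j (act (t j) z) != 0 -> U z &
      forall z, U z -> exists j, a j (act (t j) z) != 0].
Proof.
move=> tI a0 aU; split.
- move=> i j w ij; rewrite -(actVr hact (t i) w).
  apply: (wadj_wsum_delta (t := t) (s := t)) => //.
  rewrite aU coefE deltaE xpair_eqE.
  (* A non-zero value would need t_j^-1 t_i = 1, against the injectivity of t. *)
  rewrite (_ : _ == _ = false) ?mulr0//; apply/negP => /eqP.
  by move/(congr1 (fun g => t j * g)%g); rewrite mulg1 mulVKg;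
  move=> /tI/esym/eqP; rewrite (negPf ij).
- move=> j z; apply: contra_neqP => nU; apply/eqP; rewrite -sqrf_eq0 expr2.
  apply/eqP; apply: (wadj_wsum_delta (t := t) (s := t)) => //.
  by rewrite aU coefE indUE act1// memNset// mul0r.
- move=> z Uz; apply: contrapT => na.
  have az j : a j (act (t j) z) = 0.
    by apply/eqP/negPn/negP => aj; apply: na; exists j.
  have /(congr1 (fun xi : H => xi (1%g, z))) := aU (delta (1%g, z)).
  rewrite coefE deltaE eqxx indUE (act1 hact) mem_set// mul1r wadj_wsumE.
  rewrite big1 => [/esym/eqP|j _]; first by rewrite oner_eq0.
  by rewrite big1// => k _; rewrite (act1 hact) az conjC0 !mul0r.
Qed.

(** For w outside U, x applied to the basis vector at (1, t_j^-1.w) vanishes at (t_j, t_j^-1.w).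
    That value is a sum of non-negative terms, one of which is a_j(w). *)
Lemma range_coefs J (t : J -> G) (a : J -> C0 R X) j w :
  (forall j w, 0 <= a j w) ->
  (forall xi, oneU (wsum act t a xi) = wsum act t a xi) -> a j w != 0 -> U w.
Proof.
move=> a0 aU; apply: contra_neqP => nU.
have := aU (delta (1%g, act (t j)^-1%g w)).
move/(congr1 (fun xi : H => xi (t j, act (t j)^-1%g w))).
rewrite coefE actVr// indUE memNset// mul0r wsumE => /esym/eqP.
rewrite psumr_eq0 => [/allP/(_ j)|i _]; last by rewrite mulr_ge0 ?ler0n.
rewrite mem_index_enum => /(_ isT)/=.
by rewrite mulVg eqxx mulr1 actVr// => /eqP.
Qed.

Lemma isometries_paradoxical (x y : H -> H) : U !=set0 ->
  Cc_pos act x -> Cc_pos act y -> adj x \o x = oneU -> adj y \o y = oneU ->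
  cstar_le B ((x \o adj x) + (y \o adj y)) oneU ->
  paradoxical act open U.
Proof.
move=> U0 [a0 [fa a0ge] xE] [b0 [fb b0ge] yE].
have [n [s [sI a0s]]] := Cc_sum_wsum act fa; rewrite {}xE => xE.
have [m [r [rI b0r]]] := Cc_sum_wsum act fb; rewrite {}yE => yE.
have := is_adjoint_wsum hact s (a0 \o s); rewrite -xE => xx'.
have := is_adjoint_wsum hact r (b0 \o r); rewrite -yE => yy'.
rewrite (adjE xx') (adjE yy') => x'x y'y [z _ zE].
pose a := a0 \o s; pose b := b0 \o r.
have a_ge0 i w : 0 <= a i w by exact: a0ge.
have b_ge0 i w : 0 <= b i w by exact: b0ge.
have {}x'x xi : _ (x xi) = oneU xi := congr1 (fun T => T xi) x'x.
have {}y'y xi : _ (y xi) = oneU xi := congr1 (fun T => T xi) y'y.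
have [xi|Ux Uy y'x] := orthogonal_ranges oneU_selfadjoint xx' yy' x'x
  oneU_idempotent.
  (* The order relation enters only through the non-negativity of the form of z^*z. *)
  have /(congr1 (fun T => T xi)) := zE.
  by move=> /(congr1 (fun v => complex.Re (inner xi v))) => ->; exact: adj_comp_ge0.
have [|aa aU Ua] := @isometry_coefs _ s a sI a_ge0.
  by move=> xi; have := x'x xi; rewrite xE.
have [|bb bU Ub] := @isometry_coefs _ r b rI b_ge0.
  by move=> xi; have := y'y xi; rewrite yE.
(* This is y^*x = 0 tested on a basis vector, with w written as r_k.(r_k^-1.w). *)
have ab j k w : a j w * b k w = 0.
  rewrite mulrC -(actVr hact (r k) w).
  apply: (wadj_wsum_delta (t := r) (s := s)) => //.
  by have := y'x (delta ((s j)^-1 * r k, act (r k)^-1 w)%g); rewrite xE => ->.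
have aW j w : a j w != 0 -> U w.
  by apply: (@range_coefs _ s) => // xi; have := Ux xi; rewrite xE.
have bW j w : b j w != 0 -> U w.
  by apply: (@range_coefs _ r) => // xi; have := Uy xi; rewrite yE.
(* Both families are merged over a sum type, so that one disjointness statement covers all four
   cases. *)
pose c (p : 'I_n + 'I_m) := match p with inl j => a j | inr k => b k end.
pose t (p : 'I_n + 'I_m) := match p with inl j => s j | inr k => r k end.
have cc p q w : p != q -> c p w * c q w = 0.
  case: p q => [i|i] [j|j] /= ij; [exact: aa|exact: ab| |exact: bb].
  by rewrite mulrC; exact: ab.
have c_neq0 p : exists w, c p w != 0.
  have : (c p : X -> R[i]) != 0 by case: p => j /=; [exact: a0s|exact: b0r].
  apply: contra_neqP => nc; apply/funext => w; apply/eqP/negPn/negP => cw.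
  by apply: nc; exists w.
have cW p w : c p w != 0 -> U w by case: p => j /=; [exact: aW|exact: bW].
pose sp : 'I_(n + m) -> _ := @fintype.split n m.
(* The pieces are pulled back by t_p, so that t_p.V_p is exactly where c_p is non-zero. *)
pose V p := [set z | c p (act (t p) z) != 0].
have actVW p : act (t p) @` V p = [set w | c p w != 0].
  apply/seteqP; split=> [_ [v Vv <-]//|w cw].
  by exists (act (t p)^-1%g w); rewrite ?actVr// /V /= actVr.
split=> //; exists n, m, (V \o sp), (t \o sp); split=> /=.
- move=> k; split; last first.
    have [w cw] := c_neq0 (sp k).
    by exists (act (t (sp k))^-1%g w); rewrite /V /= actVr.
  (* Openness: the piece is where the modulus of a translated coefficient is positive. *)
  have -> : V (sp k) =
      [set z | 0 < normc (C0_translate hact (t (sp k)) (c (sp k)) z)].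
    apply/seteqP; split=> w; rewrite /V /mkset /= lt_def normc_ge0 andbT.
      by apply: contra_neq; exact: eq0_normc.
    by apply: contra_neq => ->; exact: normc0.
  apply: (@open_comp _ _ (fun z => normc _) [set e | 0 < e]); last exact: open_gt.
  by move=> w _; apply: continuous_normc; exact: C0_continuous.
- apply/seteqP; split=> [w [i _]|w /Ua[i aw]].
    by rewrite -[lshift m i]/(unsplit (inl i)) /sp unsplitK; exact: aU.
  by exists i => //; rewrite -[lshift m i]/(unsplit (inl i)) /sp unsplitK.
- apply/seteqP; split=> [w [i _]|w /Ub[i aw]].
    by rewrite -[rshift n i]/(unsplit (inr i)) /sp unsplitK; exact: bU.
  by exists i => //; rewrite -[rshift n i]/(unsplit (inr i)) /sp unsplitK.
- move=> k l _ _ [w []]; rewrite !actVW /= => ck cl.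
  apply: (can_inj (@splitK n m)); apply/eqP/negPn/negP => kl.
  by move/eqP: (cc _ _ w kl); rewrite mulf_eq0 (negPf ck) (negPf cl).
- by move=> k; rewrite actVW => w; exact: cW.
Qed.

End Paradoxical.

Theorem proposition4p3 (R : realType) (X : topologicalType) (G : groupType)
  (act : G -> X -> X) (hX : hausdorff_space X)
  (lcX : locally_compact [set: X]) (hact : continuous_action act)
  (U : set X) (U0 : U !=set0) (cU : compact U) (oU : open U) :
  let B : set (l2 R (G * X)%type -> l2 R (G * X)%type) :=
    reduced_crossed_product act in
  let oneU := coef act (C0_indic hX cU oU) in
  (paradoxical act open U <->
   exists x y, [/\ Cc_pos act x, Cc_pos act y,
     adj x \o x = oneU, adj y \o y = oneU &
     cstar_le B ((x \o adj x) + (y \o adj y)) oneU])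
  /\ (paradoxical act open U -> properly_infinite B oneU).
Proof.
move=> B oneU; split; first split.
- exact: paradoxical_isometries.
- by move=> [x [y [xP yP x'x y'y xy]]]; exact: isometries_paradoxical x'x y'y xy.
- move=> /(paradoxical_isometries (R := R) hX hact cU oU lcX).
  move=> [x [y [xP yP x'x y'y xy]]].
  exact: isometries_properly_infinite x'x y'y xy.
Qed.
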